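(* Every finite simplicial complex is automatic, i.e. (the geometric realization of) every finite simplicial complex is homeomorphic to an automatic space.
   Context: A set $Y\subset A^{\mathbb N}$ ($A$ a finite alphabet) is $\omega$-automatic if it is an $\omega$-regular language (accepted by a finite automaton on infinite words, e.g. a Büchi automaton). $(A^2)^{\mathbb N}$ is identified with $A^{\mathbb N}\times A^{\mathbb N}$, so relations on $A^{\mathbb N}$ can be $\omega$-automatic. An automatic space is a topological space of the form $Y/Z$ (topological quotient) where, for some finite alphabet $A$, $Y\subset A^{\mathbb N}$ is $\omega$-automatic and $Z\subset Y^2$ is a closed $\omega$-automatic equivalence relation on $Y$. *)

(* Defs.v *)
From HB Require Import structures.
From mathcomp Require Import all_boot all_order all_algebra.
From mathcomp Require Import all_classical all_reals topology.

Set Implicit Arguments.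
Unset Strict Implicit.
Unset Printing Implicit Defensive.

Import Order.TTheory GRing.Theory Num.Theory.
Import numFieldTopology.Exports.

Local Open Scope classical_set_scope.
Local Open Scope ring_scope.
Local Open Scope quotient_scope.

Record buchi_automaton (A : finType) := BuchiAutomaton {
  state : finType;
  initial : {set state};
  transition : state -> A -> state -> bool;
  accepting : {set state} }.

Definition is_run (A : finType) (M : buchi_automaton A) (w : nat -> A)
    (r : nat -> state M) : Prop :=
  r 0%N \in initial M /\ forall i, transition (r i) (w i) (r i.+1).

Definition buchi_language (A : finType) (M : buchi_automaton A) :
    set (nat -> A) :=
  [set w | exists2 r, is_run w r &
    forall n, exists2 m, (n <= m)%N & r m \in accepting M].

Definition omega_automatic (A : finType) (L : set (nat -> A)) : Prop :=
  exists M : buchi_automaton A, L = buchi_language M.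

Definition omega_words (A : finType) : topologicalType :=
  {ptws nat -> discrete_topology A}.

(* The graph of [Z], as a language over the alphabet [A * A] through the
   identification of (A^2)^N with A^N x A^N. *)
Definition relation_language (A : finType) (Y : set (omega_words A))
    (Z : rel (set_type Y)) : set (nat -> A * A) :=
  [set w | exists x y : set_type Y,
    Z x y /\ w = fun i => (set_val x i, set_val y i)].

Definition homeomorphic (S T : topologicalType) : Prop :=
  exists (f : S -> T) (g : T -> S),
    [/\ continuous f, continuous g, cancel f g & cancel g f].

(* [set_type Y] carries the subspace topology, so the closedness of [Z] is
   relative to Y x Y. Every relation being decidable classically, taking [Z]
   to be a boolean [equiv_rel] is no restriction. *)
Definition automatic (X : topologicalType) : Prop :=
  exists (A : finType) (Y : set (omega_words A)) (Z : equiv_rel (set_type Y)),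
    [/\ omega_automatic Y,
        omega_automatic (relation_language Z),
        closed [set p : set_type Y * set_type Y | Z p.1 p.2] &
        homeomorphic X (quotient_topology {eq_quot Z})].

(* The vertices are the v with [set v] in [faces]; other elements of V are not
   part of the complex. *)
Record simplicial_complex (V : finType) := SimplicialComplex {
  faces : {set {set V}};
  face_neq0 : finset.set0 \notin faces;
  face_sub : forall s t : {set V},
    s \in faces -> t \subset s -> t != finset.set0 -> t \in faces }.

(* Barycentric coordinates, in R^V with the product topology; as V is finite,
   this is the weak (coherent) topology determined by the closed simplices. *)
Definition realization_set (R : realType) (V : finType)
    (K : simplicial_complex V) : set {ptws V -> R} :=
  [set x | [/\ forall v, 0 <= x v,
               \sum_(v : V) x v = 1 &
               finset (fun v => x v != 0) \in faces K]].

Arguments realization_set R {V} K.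

Definition geometric_realization (R : realType) (V : finType)
    (K : simplicial_complex V) : topologicalType :=
  set_type (realization_set R K).

Arguments geometric_realization R {V} K.

(* Main.v *)
Require Import Defs.
From HB Require Import structures.
From mathcomp Require Import all_boot all_order all_algebra.
From mathcomp Require Import all_classical all_reals topology normedtype sequences.
From mathcomp Require Import ring lra zify.

(** A point [x] of the realization of [K] is a probability vector on the
    vertices whose support is a face.  Put [N = #|V| + 1] and take as letters
    the vectors [a] of natural numbers with sum [N]; a word [w] of such letters
    codes the point with barycentric coordinates
      [x v = \sum_i (w i v / N) / 2 ^ (i + 1)],
    which are automatically nonnegative of sum 1.

    The set [Y] of codes consists of the words all of whose letters have their
    support in one common face.  Every point has a code: since [N >= #|V|], the
    integer parts of the numbers [2 N x_v] add up to at least [N], so there is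
    a letter [a] with [a v / N <= 2 x_v] for all [v]; output [a], replace [x]
    by [2 x - a / N], which is again a probability vector supported in the same
    face, and iterate ([letter_step], [code_point_surjective]).

    An automaton recognizes [Y] by guessing the face.  Two words code the same
    point if and only if the carry [c], given by [c_0 = 0] and
    [c_(n+1) = 2 c_n + w n v - w' n v], stays in [[-N, N]] for each vertex [v]
    ([dyadic_value_eqP]); there are finitely many such carries, so a finite
    automaton can keep track of them ([kernel_automatic]).

    On the topological side, [Y] is compact by Tychonoff's theorem, the coding
    map is continuous and its target is Hausdorff, so its kernel is closed and
    the map identifies the realization with the quotient of [Y] by this kernel
    ([homeomorphic_kernel_quotient]).

    Equalities between values of series (sum of the coordinates, decoding of
    the digits of a point, the carry criterion) all reduce to [halving_eq0]: a
    bounded sequence with [e n = e (n + 1) / 2] starts at 0. *)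

Set Implicit Arguments.
Unset Strict Implicit.
Unset Printing Implicit Defensive.

Import Order.TTheory GRing.Theory Num.Theory.
Import numFieldTopology.Exports numFieldNormedType.Exports.

Local Open Scope classical_set_scope.
Local Open Scope ring_scope.
Local Open Scope quotient_scope.

(** * Dyadic series *)

Section Halving.
Variable R : realType.

Lemma le_half_expn_eq0 (x C : R) : (forall n, `|x| <= C / 2 ^+ n) -> x = 0.
Proof.
move=> xC; apply/eqP; rewrite -normr_le0.
have half_lt1 : `|2^-1 : R| < 1 by rewrite ger0_norm; lra.
have := @cvg_geometric R C _ half_lt1.
move=> cvgC; rewrite -(cvg_lim (@Rhausdorff R) cvgC).
apply: limr_ge; first by apply/cvg_ex; exists 0.
by apply: nearW => n; have := xC n; rewrite /= exprVn.
Qed.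

Lemma halving_expn (e : nat -> R) : (forall n, e n = e n.+1 / 2) ->
  forall n, e 0%N = e n / 2 ^+ n.
Proof.
move=> eS; elim=> [|n IHn]; first by rewrite expr0 divr1.
by rewrite IHn eS -mulrA -invfM -exprS.
Qed.

Lemma halving_eq0 (e : nat -> R) (C : R) :
  (forall n, `|e n| <= C) -> (forall n, e n = e n.+1 / 2) -> e 0%N = 0.
Proof.
move=> eC eS; apply: (@le_half_expn_eq0 _ C) => n.
rewrite (halving_expn eS n) normrM [X in _ * X]ger0_norm ?invr_ge0 ?exprn_ge0 //.
by rewrite ler_wpM2r // invr_ge0 exprn_ge0.
Qed.

Lemma cvg_series_half : series (fun i => 1 / 2 ^+ i.+1 : R) @ \oo --> (1 : R).
Proof.
have half_lt1 : `|2^-1 : R| < 1 by rewrite ger0_norm; lra.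
have := @cvg_geometric_series R 2^-1 _ half_lt1.
have -> : 2^-1 * (1 - 2^-1)^-1 = 1 :> R by field.
suff -> : geometric 2^-1 2^-1 = (fun i => 1 / 2 ^+ i.+1 : R) by [].
by apply/funext => i /=; rewrite exprVn exprS invfM mul1r.
Qed.

End Halving.

Section Dyadic.
Variables (R : realType) (N : nat).
Hypothesis N_gt0 : (0 < N)%N.
Implicit Types u : nat -> 'I_N.+1.

(** The number [\sum_i (u i / N) / 2 ^ (i + 1)] of the interval [[0, 1]].  The
    digits range over [0, ..., N], and expansions are not unique. *)
Definition dyadic_value u : R :=
  limn (series (fun i => (u i)%:R / N%:R / 2 ^+ i.+1 : R)).

Let N0 : N%:R != 0 :> R. Proof. by rewrite pnatr_eq0 -lt0n. Qed.

Lemma digit_itv (k : 'I_N.+1) : 0 <= (k%:R / N%:R : R) <= 1.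
Proof.
by rewrite divr_ge0//= ler_pdivrMr ?ltr0n// mul1r ler_nat -ltnS.
Qed.

Lemma is_cvg_dyadic u :
  cvgn (series (fun i => (u i)%:R / N%:R / 2 ^+ i.+1 : R)).
Proof.
apply: (@series_le_cvg R _ (fun i => 1 / 2 ^+ i.+1)) => [i|i|i|].
- by rewrite !divr_ge0 // exprn_ge0.
- by rewrite divr_ge0 // exprn_ge0.
- by rewrite ler_wpM2r ?invr_ge0 ?exprn_ge0 //; have /andP[] := digit_itv (u i).
- by apply/cvg_ex; exists 1; exact: cvg_series_half.
Qed.

Lemma dyadic_value_itv u : 0 <= dyadic_value u <= 1.
Proof.
apply/andP; split.
  apply: limr_ge; first exact: is_cvg_dyadic.
  by apply: nearW => n; apply: sumr_ge0 => i _; rewrite !divr_ge0 ?exprn_ge0.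
rewrite -(cvg_lim (@Rhausdorff R) (@cvg_series_half R)).
apply: lim_series_le; first exact: is_cvg_dyadic.
  by apply/cvg_ex; exists 1; exact: cvg_series_half.
move=> i; rewrite ler_wpM2r ?invr_ge0 ?exprn_ge0 //.
by have /andP[] := digit_itv (u i).
Qed.

Lemma dyadic_valueS u :
  dyadic_value u = (u 0%N)%:R / N%:R / 2 + dyadic_value (u \o succn) / 2.
Proof.
pose S u' : nat -> R :=
  series (fun i => (u' i : 'I_N.+1)%:R / N%:R / 2 ^+ i.+1 : R).
have SS n : S u n.+1 = (u 0%N)%:R / N%:R / 2 + S (u \o succn) n / 2.
  rewrite /S /series /= big_nat_recl //= expr1; congr (_ + _).
  rewrite mulr_suml; apply: eq_bigr => i _.
  by rewrite [in LHS]exprSr invfM !mulrA.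
have cvgS : S (u \o succn) @ \oo --> dyadic_value (u \o succn).
  exact: is_cvg_dyadic.
have cvgu : (fun n => S u n.+1) @ \oo -->
    (u 0%N)%:R / N%:R / 2 + dyadic_value (u \o succn) / 2.
  rewrite (funext SS).
  apply: cvgD; first exact: cvg_cst.
  by apply: cvgM; [exact: cvgS | exact: cvg_cst].
by apply: (cvg_lim (@Rhausdorff R)); rewrite -cvg_shiftS.
Qed.

(** The word [w] without its first [n] letters. *)
Definition word_tail (T : Type) (n : nat) (w : nat -> T) : nat -> T :=
  fun i => w (n + i)%N.

Lemma dyadic_value_tailS u n : dyadic_value (word_tail n u) =
  (u n)%:R / N%:R / 2 + dyadic_value (word_tail n.+1 u) / 2.
Proof.
rewrite dyadic_valueS /word_tail addn0; congr (_ + dyadic_value _ / 2).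
by apply/funext => i /=; rewrite addnS.
Qed.

Lemma word_tail0 (T : Type) (w : nat -> T) : word_tail 0 w = w.
Proof. by apply/funext. Qed.

(** If the remainders [x n] left after writing [n] digits of [u] stay bounded,
    then [u] is an expansion of [x 0]. *)
Lemma dyadic_value_unique u (x : nat -> R) (C : R) :
  (forall n, `|x n| <= C) ->
  (forall n, x n.+1 = 2 * x n - (u n)%:R / N%:R) -> x 0%N = dyadic_value u.
Proof.
move=> xC xS; apply/eqP; rewrite -subr_eq0 -{1}(word_tail0 u); apply/eqP.
apply: (@halving_eq0 R (fun n => x n - dyadic_value (word_tail n u)) (C + 1)) => n.
  apply: (le_trans (ler_normB _ _)); rewrite lerD //.
  have /andP[v0 v1] := dyadic_value_itv (word_tail n u).
  by rewrite ger0_norm.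
by rewrite dyadic_value_tailS xS; lra.
Qed.

Lemma dyadic_value_eq0 u : (forall i, u i = ord0) -> dyadic_value u = 0.
Proof.
move=> u0; apply/esym.
apply: (@dyadic_value_unique u (fun=> 0) 0) => n; rewrite ?normr0 // u0 /=.
by rewrite mul0r mulr0 subr0.
Qed.

Lemma dyadic_value_prefix u u' n : (forall i, (i < n)%N -> u i = u' i) ->
  `|dyadic_value u - dyadic_value u'| <= 1 / 2 ^+ n.
Proof.
elim: n u u' => [|n IHn] u u' uu'.
  have /andP[? ?] := dyadic_value_itv u; have /andP[? ?] := dyadic_value_itv u'.
  by rewrite expr0 ler_norml; lra.
rewrite (dyadic_valueS u) (dyadic_valueS u') uu' //.
rewrite opprD addrACA subrr add0r -mulrBl normrM exprSr invfM mulrA.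
rewrite [`|2^-1|]ger0_norm ?invr_ge0 // ler_wpM2r ?invr_ge0 //.
by apply: IHn => i ltin; rewrite /= uu'.
Qed.

(** Two digit sequences have the same value if and only if the carry of their
    difference stays in [[-N, N]].  The sequence [c] is this carry shifted by
    [N], so that it takes its values in the natural numbers up to [2 N]. *)
Lemma dyadic_value_eqP u u' : dyadic_value u = dyadic_value u' <->
  exists c : nat -> 'I_N.*2.+1, c 0%N = N :> nat /\
    forall n, (c n.+1 + N + u' n = (c n).*2 + u n)%N.
Proof.
have natr_double k : k.*2%:R = 2 * k%:R :> R by rewrite -mul2n natrM.
split=> [uu'|[c [c0 cS]]]; last first.
  (* Conversely, the remainders of [u] differ from those of [u'] by the
     bounded sequence of the opposite carries divided by [N]. *)
  have := @dyadic_value_unique u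
    (fun n => ((N%:R - (c n)%:R) / N%:R) + dyadic_value (word_tail n u')) 2.
  rewrite c0 subrr mul0r add0r word_tail0 => -> // n.
    have /andP[v0 v1] := dyadic_value_itv (word_tail n u').
    have -> : (N%:R - (c n)%:R) / N%:R = 1 - (c n)%:R / N%:R :> R.
      by rewrite mulrBl divff.
    have cn0 : 0 <= (c n)%:R / N%:R :> R by rewrite divr_ge0.
    have cn2 : (c n)%:R / N%:R <= 2 :> R.
      by rewrite ler_pdivrMr ?ltr0n // -natrM ler_nat mul2n -ltnS.
    by rewrite ler_norml; lra.
  rewrite (dyadic_value_tailS _ n).
  have /(congr1 (fun k => k%:R : R)) := cS n.
  rewrite !natrD natr_double => cSn.
  have -> : (c n.+1)%:R = 2 * (c n)%:R + (u n)%:R - N%:R - (u' n)%:R :> R by lra.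
  by field.
(* If the values agree, the carry at time [n] is [N * gap n], which is an
   integer by induction and lies in [[-N, N]]. *)
pose gap n := dyadic_value (word_tail n u') - dyadic_value (word_tail n u).
have gap_itv n : -1 <= gap n <= 1.
  have /andP[? ?] := dyadic_value_itv (word_tail n u).
  have /andP[? ?] := dyadic_value_itv (word_tail n u').
  by rewrite /gap; lra.
have gapS n : N%:R * gap n.+1 = 2 * (N%:R * gap n) + (u n)%:R - (u' n)%:R.
  by rewrite /gap !(dyadic_value_tailS _ n); field.
have carry n : exists k : 'I_N.*2.+1, k%:R = N%:R + N%:R * gap n :> R.
  have N_ge0 : 0 <= N%:R :> R by [].
  elim: n => [|n [k kE]].
    rewrite /gap !word_tail0 uu' subrr mulr0 addr0.
    have ltN : (N < N.*2.+1)%N by lia.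
    by exists (Ordinal ltN).
  have lb : N%:R * -1 <= N%:R * gap n.+1.
    by rewrite ler_wpM2l //; have /andP[] := gap_itv n.+1.
  have ub : N%:R * gap n.+1 <= N%:R * 1.
    by rewrite ler_wpM2l //; have /andP[] := gap_itv n.+1.
  have le1 : (N + u' n <= k.*2 + u n)%N.
    rewrite -(ler_nat R) !natrD natr_double kE.
    by move: lb; rewrite gapS; lra.
  have lt2 : (k.*2 + u n - (N + u' n) < N.*2.+1)%N.
    rewrite ltnS -(ler_nat R) natrB // !natrD !natr_double kE.
    by move: ub; rewrite gapS; lra.
  exists (Ordinal lt2) => /=.
  by rewrite gapS natrB // !natrD natr_double kE; lra.
have [c cE] := choice carry; exists c; split=> [|n].
  apply/eqP; rewrite -(eqr_nat R) cE /gap !word_tail0 uu' subrr mulr0 addr0.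
  exact/eqP.
apply/eqP; rewrite -(eqr_nat R) !natrD natr_double !cE gapS; apply/eqP; lra.
Qed.

End Dyadic.

(** * Quotients of compact spaces *)

(** The relation of having the same image under [p]. *)
Definition kernel_rel (S : choiceType) (T : eqType) (p : S -> T) : rel S :=
  fun x y => p x == p y.

Lemma kernel_rel_equiv (S : choiceType) (T : eqType) (p : S -> T) :
  equiv_class_of (kernel_rel p).
Proof.
split=> [x|x y|y x z]; rewrite /kernel_rel ?eqxx //.
by move=> /eqP -> /eqP ->.
Qed.

Canonical kernel_equiv_rel (S : choiceType) (T : eqType) (p : S -> T) :=
  EquivRelPack (kernel_rel_equiv p).

(** A continuous surjection [p] from a compact space onto a Hausdorff space is a
    quotient map, so its target is the quotient by the kernel of [p]. *)
Lemma homeomorphic_kernel_quotient (S T : topologicalType) (p : S -> T) :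
  compact [set: S] -> hausdorff_space T -> continuous p ->
  (forall t, exists s, p s = t) ->
  homeomorphic T (quotient_topology {eq_quot kernel_equiv_rel p}).
Proof.
move=> cptS hsT ctp p_surj; have [sec secK] := choice p_surj.
pose Q := quotient_topology {eq_quot kernel_equiv_rel p}.
have pi_eq x y : \pi_Q%qT x = \pi_Q%qT y <-> p x = p y.
  by split=> [/eqmodP/eqP|/eqP pxy] //; apply/eqmodP.
have reprp x : p (repr (\pi_Q%qT x)) = p x by apply/pi_eq; exact: reprK.
exists (fun t => \pi_Q%qT (sec t)), (p \o repr); split.
- apply/continuous_closedP => C clC.
  (* The preimage of the closed set [C] is the image of a compact set. *)
  have -> : (fun t => \pi_Q%qT (sec t)) @^-1` C = p @` (\pi_Q%qT @^-1` C).
    apply/seteqP; split=> [t Ct|_ [s Cs <-]].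
      by exists (sec t).
    by rewrite /preimage /= (_ : \pi_Q%qT (sec (p s)) = \pi_Q%qT s) //; apply/pi_eq.
  apply: compact_closed => //; apply: continuous_compact.
    exact: continuous_subspaceT.
  apply: (subclosed_compact _ cptS) => //.
  by move/continuous_closedP: (@pi_continuous S {eq_quot kernel_equiv_rel p}); apply.
- apply: repr_comp_continuous => // x y /eqP /pi_eq ->; exact: eqxx.
- by move=> t /=; rewrite reprp.
- by move=> q /=; rewrite -[q in RHS]reprK; apply/pi_eq; rewrite secK.
Qed.

Lemma continuous_into_set_type (S T : topologicalType) (A : set T)
  (f : S -> set_type A) : continuous (set_val \o f) -> continuous f.
Proof.
move=> /continuousP ctf; apply/continuousP => _ [B oB <-].
exact: (ctf B oB).
Qed.

Lemma continuous_into_ptws (S T : topologicalType) (I : eqType)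
  (f : S -> {ptws I -> T}) : (forall i, continuous (fun s => f s i)) -> continuous f.
Proof.
move=> ctf s; apply/cvg_sup => i U [_ [[W oW <-] Wfs] WU].
apply: (filterS WU).
exact: (ctf i s W (open_nbhs_nbhs (conj oW Wfs))).
Qed.

Lemma compact_set_typeT (T : topologicalType) (A : set T) :
  compact A -> compact [set: set_type A].
Proof.
move=> cptA F FF _.
have FA : (set_val @ F) A.
  by apply: (@filterS _ F _ setT) filterT => x _; exact: set_valP.
have [a [Aa aF]] := cptA _ _ FA.
exists (exist _ a (mem_set Aa)); split=> // G U FG [_ [[W oW <-] Wa] WU].
have FG' : (set_val @ F) (set_val @` G).
  by apply: (@filterS _ F _ G) FG => x Gx; exists x.
have [_ [[x Gx <-] Wx]] := aF _ _ FG' (open_nbhs_nbhs (conj oW Wa)).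
by exists x; split=> //; exact: WU.
Qed.

Lemma hausdorff_set_type (T : topologicalType) (A : set T) :
  hausdorff_space T -> hausdorff_space (set_type A).
Proof.
move=> hsT x y xy; apply: val_inj; apply: hsT => U V xU yV.
have cv := @initial_continuous (set_type A) T set_val.
have [z [Uz Vz]] := xy _ _ (cv x U xU) (cv y V yV).
by exists (set_val z).
Qed.

Lemma kernel_equiv_rel_closed (S T : topologicalType) (p : S -> T) :
  hausdorff_space T -> continuous p ->
  closed [set q : S * S | kernel_equiv_rel p q.1 q.2].
Proof.
move=> hsT ctp [x y] xy; apply/eqP; apply: hsT => U W xU yW.
have [[x' y'] [/eqP /= x'y' [/= Ux' Wy']]] :
    [set q : S * S | kernel_equiv_rel p q.1 q.2] `&`
    (p @^-1` U `*` p @^-1` W) !=set0.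
  by apply: xy; exists (p @^-1` U, p @^-1` W) => //; split; [exact: ctp|exact: ctp].
by exists (p x'); split=> //; rewrite x'y'.
Qed.

(** * Coding the points of a complex by words *)

Lemma nbhs_prefix (A : finType) (w : omega_words A) (n : nat) :
  nbhs w [set w' : omega_words A | forall i, (i < n)%N -> w' i = w i].
Proof.
elim: n => [|n IHn]; first by apply: filterS filterT => w' _ i.
have wn : nbhs w [set w' : omega_words A | w' n = w n].
  exact: (@proj_continuous _ (fun=> discrete_topology A) n w _ (discrete_set1 (w n))).
apply: filterS (filterI IHn wn) => w' [w'w w'n] i.
by rewrite ltnS leq_eqVlt => /predU1P[->//|]; exact: w'w.
Qed.

(** A natural number below the sum of [b] is the sum of some [a <= b]. *)
Lemma nat_fun_truncate (V : finType) (b : V -> nat) (m : nat) :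
  (m <= \sum_v b v)%N ->
  exists a : V -> nat, (forall v, (a v <= b v)%N) /\ (\sum_v a v)%N = m.
Proof.
elim: m => [_|m IHm lt_mb]; first by exists (fun=> 0%N); rewrite big1.
have [a [le_ab sum_a]] := IHm (ltnW lt_mb).
have [v lt_v] : exists v, (a v < b v)%N.
  apply: contrapT => /forallNP nlt; move: lt_mb; rewrite -sum_a ltnNge.
  by rewrite leq_sum // => v _; rewrite leqNgt; apply/negP.
exists (fun u => a u + (u == v))%N; split=> [u|].
  by case: eqVneq => [->|_]; rewrite ?addn1 ?addn0.
rewrite big_split sum_a (bigD1 v) //= eqxx big1 ?addn1 // => u.
by case: eqVneq.
Qed.

Section Code.
Variables (R : realType) (V : finType).

(** The common denominator [N] of the letters.  Surjectivity of the coding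
    needs [#|V| <= N]; the successor makes [N] positive even if [V] is empty. *)
Definition denominator : nat := #|V|.+1.
Notation N := denominator.

(** All vectors of integers between [0] and [N]; that the entries of a letter
    have sum [N] is imposed by [letter_in]. *)
Definition letter : finType := {ffun V -> 'I_N.+1}.

Implicit Types (F : {set V}) (a : letter) (w : nat -> letter).

(** The entries of [a] have sum [N], and the support of [a] lies in [F]. *)
Definition letter_in (F : {set V}) (a : letter) : bool :=
  (\sum_v a v == N)%N && [forall v, (a v != 0%N :> nat) ==> (v \in F)].

Lemma letter_inP F a : reflect
  ((\sum_v a v)%N = N /\ forall v, a v != 0%N :> nat -> v \in F)
  (letter_in F a).
Proof.
apply: (iffP andP) => -[/eqP sa aF]; split=> //.
  by move=> v; move/forallP/(_ v)/implyP: aF.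
by apply/forallP => v; apply/implyP; exact: aF.
Qed.

(** The barycentric coordinate at [v] of the point coded by [w]. *)
Definition coordinate (w : nat -> letter) (v : V) : R :=
  dyadic_value R (fun i => w i v).

Lemma coordinate_ge0 w v : 0 <= coordinate w v.
Proof. by have /andP[] := dyadic_value_itv R (ltn0Sn #|V|) (fun i => w i v). Qed.

Lemma coordinate_tailS w n v : coordinate (word_tail n w) v =
  (w n v)%:R / N%:R / 2 + coordinate (word_tail n.+1 w) v / 2.
Proof. exact: (dyadic_value_tailS R (ltn0Sn _) (fun i => w i v)). Qed.

Lemma coordinate_sum w :
  (forall i, \sum_v w i v = N)%N -> \sum_v coordinate w v = 1.
Proof.
move=> wN; apply/eqP; rewrite -subr_eq0 -(word_tail0 w); apply/eqP.
apply: (@halving_eq0 R (fun n => \sum_v coordinate (word_tail n w) v - 1)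
  (#|V|%:R + 1)) => n.
  apply: (le_trans (ler_normB _ _)); rewrite normr1 lerD2r.
  apply: (le_trans (ler_norm_sum _ _ _)).
  rewrite -sum1_card natr_sum; apply: ler_sum => v _.
  have /andP[v0 v1] := dyadic_value_itv R (ltn0Sn #|V|) (fun i => word_tail n w i v).
  by rewrite ger0_norm.
under eq_bigr do rewrite coordinate_tailS.
rewrite big_split /= -!mulr_suml -natr_sum wN divff ?pnatr_eq0 //.
lra.
Qed.

Lemma coordinate_continuous v :
  continuous (fun w : omega_words letter => coordinate w v).
Proof.
move=> w; have filter_w := nbhs_filter (w : omega_words letter).
apply/cvgrPdist_le => e e0.
have [n le_ne] : exists n, 1 / 2 ^+ n <= e :> R.
  apply: contrapT => /forallNP nle.
  suff : e = 0 by apply/eqP; rewrite gt_eqF.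
  apply: (@le_half_expn_eq0 _ _ 1) => n; rewrite ger0_norm ?ltW //.
  by rewrite ltNge; apply/negP; exact: nle.
apply: filterS (nbhs_prefix w n) => w' w'w.
apply: le_trans le_ne; apply: dyadic_value_prefix => // i ltin.
by rewrite w'w.
Qed.

Variable K : simplicial_complex V.

(** The set of codes of the points of [K]. *)
Definition code_set : set (omega_words letter) :=
  [set w | exists2 F, F \in faces K & forall i, letter_in F (w i)].

Lemma code_set_compact : compact code_set.
Proof.
pose in_face F : set (omega_words letter) := [set w | forall i, letter_in F (w i)].
have -> : code_set = \big[setU/set0]_(F <- enum (faces K)) in_face F.
  rewrite -bigcup_seq; apply/seteqP; split=> w [F FK wF]; exists F => //.
    by rewrite /= mem_enum.
  by move: FK; rewrite /= mem_enum.
apply: bigsetU_compact => F _.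
apply: (@tychonoff nat (fun=> discrete_topology letter)
  (fun=> [set a | letter_in F a])) => _.
by apply: finite_compact; exact: (finite_finset).
Qed.

Lemma coordinate_realization w : code_set w -> realization_set R K (coordinate w).
Proof.
move=> [F FK /(_ _)/letter_inP wF]; split=> [v||].
- exact: coordinate_ge0.
- by apply: coordinate_sum => i; have [] := wF i.
apply: (face_sub FK).
  apply/fintype.subsetP => v; rewrite inE; apply: contraNT => vF.
  apply/eqP; apply: dyadic_value_eq0 => // i; apply: val_inj => /=.
  by apply/eqP; apply: contraNT vF; exact: (wF i).2.
apply/negP => /eqP supp0.
have /eqP := coordinate_sum (fun i => (wF i).1).
rewrite big1 ?(eq_sym 0) ?oner_eq0 // => v _; apply/eqP.
by have := finset.in_set0 v; rewrite -supp0 inE => /negbFE.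
Qed.

(** The point of the realization coded by [w]. *)
Definition code_point (w : set_type code_set) : geometric_realization R K :=
  exist _ (coordinate (set_val w)) (mem_set (coordinate_realization (set_valP w))).

Lemma code_point_continuous : continuous code_point.
Proof.
apply: continuous_into_set_type; apply: continuous_into_ptws => v.
move=> w U /coordinate_continuous; exact: initial_continuous.
Qed.

Lemma geometric_realization_hausdorff : hausdorff_space (geometric_realization R K).
Proof.
apply: hausdorff_set_type; apply: hausdorff_product => v; exact: Rhausdorff.
Qed.

(** The greedy choice of the first letter of a code of [x]. *)
Lemma letter_step F (x : V -> R) : (forall v, 0 <= x v) -> \sum_v x v = 1 ->
  (forall v, x v != 0 -> v \in F) ->
  exists2 a, letter_in F a & forall v, (a v)%:R / N%:R <= 2 * x v.
Proof.
move=> x0 x1 xF; pose b v := Num.truncn (2 * N%:R * x v).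
have b_itv v : (b v)%:R <= 2 * N%:R * x v < (b v).+1%:R.
  by apply: truncn_itv; rewrite !mulr_ge0.
have le_Nb : (N <= \sum_v b v)%N.
  (* Each integer part loses less than 1, and there are [#|V| < N] of them. *)
  suff : (N.*2 <= \sum_v b v + #|V|)%N by rewrite /N; lia.
  have Nx : N.*2%:R = \sum_v 2 * N%:R * x v :> R.
    by rewrite -mulr_sumr x1 mulr1 -mul2n natrM.
  rewrite -(ler_nat R) Nx -sum1_card -big_split natr_sum /=; apply: ler_sum => v _.
  by rewrite addn1 ltW //; have /andP[] := b_itv v.
have [a [le_ab sum_a]] := nat_fun_truncate le_Nb.
have lt_aN v : (a v < N.+1)%N by rewrite ltnS -sum_a (bigD1 v) //= leq_addr.
exists [ffun v => Ordinal (lt_aN v)].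
  apply/letter_inP; split=> [|v].
    by rewrite -[RHS]sum_a; apply: eq_bigr => v _; rewrite ffunE.
  rewrite ffunE /= => av0; apply: xF; apply: contra_neq av0 => xv0.
  have /andP[bv _] := b_itv v; move: bv; rewrite xv0 mulr0 lern0 => /eqP bv0.
  by apply/eqP; rewrite -leqn0 -[X in (_ <= X)%N]bv0.
move=> v; rewrite ffunE /= ler_pdivrMr ?ltr0n // mulrAC.
have /andP[bv _] := b_itv v; apply: le_trans bv.
by rewrite ler_nat.
Qed.

Lemma code_point_surjective x : exists w : set_type code_set, code_point w = x.
Proof.
case: x => x xP; have [x0 x1 xK] := set_mem xP.
pose F := finset (fun v => x v != 0).
pose good (y : V -> R) := [/\ forall v, 0 <= y v, \sum_v y v = 1 &
  forall v, y v != 0 -> v \in F].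
have digit_ex (y : V -> R) : exists a : letter, good y ->
    letter_in F a /\ forall v, (a v)%:R / N%:R <= 2 * y v.
  have [[y0 y1 yF]|ngood] := pselect (good y); last by exists [ffun=> ord0].
  by have [a aF ay] := letter_step y0 y1 yF; exists a.
have [digit digitP] := choice digit_ex.
(* [next] is the remainder after one digit; the remainders stay good, and
   therefore their coordinates stay in [[0, 1]]. *)
pose next (y : V -> R) v := 2 * y v - (digit y v)%:R / N%:R.
have next_good y : good y -> good (next y).
  move=> gy; have [y0 y1 yF] := gy; have [/letter_inP[aN aF] ay] := digitP y gy.
  split=> [v||v].
  - by rewrite /next subr_ge0.
  - rewrite /next sumrB -mulr_sumr -mulr_suml -natr_sum y1 aN divff ?pnatr_eq0 //.
    by lra.
  - apply: contraNT => vF; rewrite /next.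
    have -> : y v = 0 by apply/eqP; apply: contraNT vF; exact: yF.
    have -> : nat_of_ord (digit y v) = 0%N.
      by apply/eqP; apply: contraNT vF; exact: aF.
    by rewrite mulr0 mul0r subr0.
pose y n := iter n next x.
have y_good n : good (y n).
  elim: n => [|n IHn]; last exact: next_good.
  by split=> // v xv; rewrite inE.
pose w : omega_words letter := fun i => digit (y i).
have wY : code_set w.
  by exists F => // i; have [] := digitP _ (y_good i).
exists (exist _ w (mem_set wY)); apply: val_inj; apply/funext => v /=.
apply/esym; apply: (@dyadic_value_unique R N (ltn0Sn _) (fun i => w i v)
  (fun n => y n v) 1) => // n.
have [yn0 yn1 _] := y_good n.
by rewrite ger0_norm // -yn1 (bigD1 v) //= lerDl sumr_ge0.
Qed.

(** * The automata *)

(** The state is the face guessed at the start; every infinite run is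
    accepting. *)
Definition code_automaton : buchi_automaton letter :=
  @BuchiAutomaton letter {set V} (faces K)
    (fun F a F' => (F == F') && letter_in F a) finset.setT.

Lemma code_set_automatic : omega_automatic code_set.
Proof.
exists code_automaton; apply/seteqP; split=> w.
  move=> [F FK wF]; exists (fun=> F); last by move=> n; exists n; rewrite ?finset.in_setT.
  by split=> //= i; rewrite eqxx wF.
move=> [r [r0 rS] _]; have rE n : r n = r 0%N.
  by elim: n => // n <-; have /andP[/eqP] := rS n.
by exists (r 0%N) => // i; have /andP[_] := rS i; rewrite rE.
Qed.

(** A face for each of the two words, and the carry at each vertex, shifted by
    [N] as in [dyadic_value_eqP]. *)
Definition kernel_state : Type :=
  ({set V} * {set V} * {ffun V -> 'I_N.*2.+1})%type.

Definition kernel_initial (s : kernel_state) : bool :=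
  [&& s.1.1 \in faces K, s.1.2 \in faces K & [forall v, s.2 v == N :> nat]].

(** The faces are constant and the carries are updated; a carry that would
    leave its range blocks the run. *)
Definition kernel_transition (s : kernel_state) (p : letter * letter)
    (t : kernel_state) : bool :=
  [&& s.1 == t.1, letter_in s.1.1 p.1, letter_in s.1.2 p.2
    & [forall v, t.2 v + N + p.2 v == (s.2 v).*2 + p.1 v]%N].

(** Every infinite run is accepting. *)
Definition kernel_automaton : buchi_automaton (letter * letter)%type :=
  @BuchiAutomaton (letter * letter)%type
    ({set V} * {set V} * {ffun V -> 'I_N.*2.+1})%type
    (finset kernel_initial) kernel_transition finset.setT.

Lemma kernel_automatic :
  omega_automatic (relation_language (kernel_equiv_rel code_point)).
Proof.
exists kernel_automaton; apply/seteqP; split=> w.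
  move=> [x [y [/eqP/(congr1 set_val) xy ->]]].
  have [F FK xF] := set_valP x; have [G GK yG] := set_valP y.
  have carry v : exists c : nat -> 'I_N.*2.+1, c 0%N = N :> nat /\
      forall n, (c n.+1 + N + set_val y n v = (c n).*2 + set_val x n v)%N.
    have /(congr1 (fun f => f v)) := xy.
    exact: (dyadic_value_eqP R (ltn0Sn _) _ _).1.
  have [c cP] := choice carry.
  exists (fun n => (F, G, [ffun v => c v n])); last first.
    by move=> n; exists n; rewrite ?finset.in_setT.
  split=> [|i]; rewrite ?inE /=.
    by rewrite /kernel_initial FK GK /=; apply/forallP => v; rewrite ffunE (cP v).1.
  rewrite /kernel_transition eqxx xF yG /=; apply/forallP => v.
  by rewrite !ffunE (cP v).2.
move=> [r [r0 rS] _].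
have rE n : (r n).1 = (r 0%N).1.
  by elim: n => // n <-; have /and4P[/eqP] := rS n.
move: r0; rewrite inE => /and3P[FK GK /forallP c0].
have xY : code_set (fun i => (w i).1).
  by exists (r 0%N).1.1 => // i; have /and4P[_] := rS i; rewrite rE.
have yY : code_set (fun i => (w i).2).
  by exists (r 0%N).1.2 => // i; have /and4P[_ _] := rS i; rewrite rE.
pose x : set_type code_set := exist _ (fun i => (w i).1) (mem_set xY).
pose y : set_type code_set := exist _ (fun i => (w i).2) (mem_set yY).
exists x, y; split; last first.
  by apply/funext => i; exact: surjective_pairing.
apply/eqP; apply: val_inj; apply/funext => v /=.
apply: (dyadic_value_eqP R (ltn0Sn _) _ _).2.
exists (fun n => (r n).2 v); split=> [|n]; first exact/eqP/c0.
by have /and4P[_ _ _ /forallP/(_ v)/eqP] := rS n.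
Qed.

End Code.

Theorem theorem8p1 (R : realType) (V : finType) (K : simplicial_complex V) :
  automatic (geometric_realization R K).
Proof.
exists (letter V), (code_set K), (kernel_equiv_rel (@code_point R V K)); split.
- exact: code_set_automatic.
- exact: kernel_automatic.
- apply: kernel_equiv_rel_closed; last exact: code_point_continuous.
  exact: geometric_realization_hausdorff.
- apply: homeomorphic_kernel_quotient.
  + exact/compact_set_typeT/code_set_compact.
  + exact: geometric_realization_hausdorff.
  + exact: code_point_continuous.
  + exact: code_point_surjective.
Qed.
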